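(* There is no general ordering between the first-visit Monte Carlo (MC) estimator and the maximum likelihood (ML, equivalently LSTD) value estimator: there exist a Markov Reward Process, a state $s$ and a number $n$ of observed i.i.d. paths for which the MC estimator of $V_s$ has strictly smaller mean squared error than the ML value estimator of $V_s$, and there exist a Markov Reward Process, a state $s$ and a number $n$ of observed i.i.d. paths for which the ML value estimator of $V_s$ has strictly smaller mean squared error than the MC estimator.
   Context: A Markov Reward Process (MRP) has a finite state space, starting probabilities $p_i$, transition probabilities $p_{ij}$, rewards $R_{ij}$ received on a transition $i\to j$, and a discount $\gamma\in(0,1]$. Terminal states have no outgoing transitions and value $0$. The value is $V_i=\sum_j p_{ij}(\mathbb E[R_{ij}]+\gamma V_j)$. The sample consists of $n$ i.i.d. paths, each run until a terminal state, with their rewards; $K_i$ is the total number of visits to $i$ and $\mu_{ij}$ the number of observed direct transitions $i\to j$. The mean squared error of an estimator $T$ of $V_s$ is $\mathbb E[(T-V_s)^2]$ (the state $s$ may be taken to be visited with probability one). The first-visit Monte Carlo estimator of $V_s$ is the average, over all observed paths that visit $s$, of the discounted sum of rewards following the first visit to $s$ in that path. ML value estimator: $\bar p_{ij}=\mu_{ij}/K_i$ ($\bar p_{ij}=0$ if $K_i=0$), $\bar{\mathbf P}=(\bar p_{ij})$, $\bar r_i=\sum_j\bar p_{ij}\bar R_{ij}$ with $\bar R_{ij}$ the ML estimate of $\mathbb E[R_{ij}]$ (equal to $R_{ij}$ for deterministic rewards); the estimator is the vector $(\mathbf I-\gamma\bar{\mathbf P})^{-1}\bar{\mathbf r}$.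 *)

(* Defs.v *)
From HB Require Import structures.
From mathcomp Require Import all_boot all_order all_algebra.
From mathcomp Require Import all_classical all_reals all_analysis.
Set Implicit Arguments.
Unset Strict Implicit.
Unset Printing Implicit Defensive.
Import Order.TTheory GRing.Theory Num.Theory.
Local Open Scope classical_set_scope.
Local Open Scope ring_scope.

(* The reward of a transition i -> j is a real random variable with law
   [reward_law i j]; a deterministic reward is a Dirac mass. *)
Record MRP (R : realType) := {
  nstates : nat;
  start : 'I_nstates -> R;
  trans : 'M[R]_nstates;
  reward_law : 'I_nstates -> 'I_nstates ->
    probability (measurableTypeR R) R;
  discount : R;
  start_ge0 : forall i, 0 <= start i;
  start_sum1 : \sum_i start i = 1;
  trans_ge0 : forall i j, 0 <= trans i j;
  (* a state either is terminal (zero row) or has a stochastic row *)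
  trans_sum1 : forall i, (forall j, trans i j = 0) \/ \sum_j trans i j = 1;
  reward_integrable : forall i j,
    (reward_law i j).-integrable setT (fun x : measurableTypeR R => x%:E);
  discount_gt0 : 0 < discount;
  discount_le1 : discount <= 1;
  (* every run ends almost surely: from each state some terminal state is
     reachable; with a finite state space this is equivalent, and it makes the
     solution of the value equation unique even for discount 1 *)
  absorbing : forall i, exists2 t, (forall j, trans t j = 0) &
    connect [rel k l | 0 < trans k l] i t
}.

Arguments start {R} m i.
Arguments trans {R} m.
Arguments reward_law {R} m i j.
Arguments discount {R} m.

Section MarkovRewardProcess.
Context {R : realType} (M : MRP R).
Local Notation state := 'I_(nstates M).

Definition terminal (i : state) : bool := [forall j, trans M i j == 0].

Definition mean_reward (i j : state) : R :=
  \int[reward_law M i j]_x (x : R).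

Definition is_value (V : state -> R) : Prop :=
  forall i, V i =
    \sum_j trans M i j * (mean_reward i j + discount M * V j).

(* A run is a pair (x, r): x lists the visited states, from the initial state
   to the terminal one included, and r t is the reward of the transition from
   the t-th to the (t+1)-st state of x, for t.+1 < size x; the other values
   of r are irrelevant. *)
Definition run : Type := seq state * (nat -> R).

(* Probability that the MRP, currently in state i, goes on exactly through the
   states of y and stops there, with t-th reward in B t. *)
Fixpoint walk_law (i : state) (y : seq state) (B : nat -> set R) : \bar R :=
  match y with
  | [::] => ((terminal i)%:R)%:E
  | j :: y' =>
      ((trans M i j)%:E * reward_law M i j (B 0%N)
        * walk_law j y' (fun t => B t.+1))%E
  end.

Definition run_law (x : seq state) (B : nat -> set R) : \bar R :=
  match x with
  | [::] => 0%E
  | i :: y => ((start M i)%:E * walk_law i y B)%E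
  end.

(* The basic events about a run. They form, together with set0, a pi-system
   generating the sigma-algebra of the observed run (x and the r t with
   t.+1 < size x), so that prescribing their probabilities and
   requiring the product rule on them amounts to prescribing the law of each
   run and the mutual independence of the runs. *)
Definition run_event (T : Type) (X : T -> run)
    (x : seq state) (B : nat -> set R) : set T :=
  [set w | (X w).1 = x /\ forall t, (t.+1 < size x)%N -> B t ((X w).2 t)].

Record iid_sample (n : nat) (d : measure_display) (T : measurableType d)
    (P : probability T R) := {
  sample :> 'I_n -> T -> run;
  measurable_states : forall k x, measurable [set w | (sample k w).1 = x];
  measurable_rewards : forall k t,
    measurable_fun setT (fun w => (sample k w).2 t);
  sample_law : forall k x (B : nat -> set R),
    (forall t, measurable (B t)) ->
    P (run_event (sample k) x B) = run_law x B;
  sample_indep : forall (J : {set 'I_n}) (x : 'I_n -> seq state)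
      (B : 'I_n -> nat -> set R),
    (forall k t, measurable (B k t)) ->
    P (\bigcap_(k in [set` J]) run_event (sample k) (x k) (B k)) =
    (\prod_(k in J) P (run_event (sample k) (x k) (B k)))%E
}.

Section Estimators.
Context {n : nat} (D : 'I_n -> run).

(* discounted sum of the rewards that follow the first visit to s *)
Definition first_visit_return (s : state) (p : run) : R :=
  \sum_(index s p.1 <= t < (size p.1).-1)
    discount M ^+ (t - index s p.1) * p.2 t.

(* 0 when no run visits s *)
Definition mc_estimator (s : state) : R :=
  (\sum_(k < n | s \in (D k).1) first_visit_return s (D k))
    / #|[pred k | s \in (D k).1]|%:R.

Definition transitions (x : seq state) : seq (state * state) :=
  zip x (behead x).

Definition visits (i : state) : nat :=
  (\sum_(k < n) count_mem i (D k).1)%N.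

Definition trans_count (i j : state) : nat :=
  (\sum_(k < n) count_mem (i, j) (transitions (D k).1))%N.

(* 0 when visits i = 0, as x / 0 = 0 *)
Definition ml_trans : 'M[R]_(nstates M) :=
  \matrix_(i, j) ((trans_count i j)%:R / (visits i)%:R).

Definition reward_sum (i j : state) : R :=
  \sum_(k < n) \sum_(t < (size (D k).1).-1 |
                     nth (i, i) (transitions (D k).1) t == (i, j)) (D k).2 t.

(* The sample mean of the observed rewards of i -> j, i.e. the mean of their
   empirical law, the maximum likelihood estimate over all reward laws; if the
   reward is a constant it is that constant. Its value for an unobserved
   transition is irrelevant since then ml_trans i j = 0. *)
Definition ml_mean_reward (i j : state) : R :=
  reward_sum i j / (trans_count i j)%:R.

Definition ml_reward : 'cV[R]_(nstates M) :=
  \col_i \sum_j ml_trans i j * ml_mean_reward i j.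

(* The matrix is invertible for every family of runs of positive probability:
   in each of them every visited state leads to a terminal one. *)
Definition ml_value : 'cV[R]_(nstates M) :=
  invmx (1%:M - discount M *: ml_trans) *m ml_reward.

Definition ml_estimator (s : state) : R := ml_value s ord0.

End Estimators.

(* Mean squared error of the estimator T of a real v on the sample X *)
Definition mse (n : nat) (d : measure_display) (T : measurableType d)
    (P : probability T R) (X : iid_sample n P)
    (est : ('I_n -> run) -> R) (v : R) : \bar R :=
  'E_P[(fun w => (est (X ^~ w) - v) ^+ 2)].

Definition as_visited (n : nat) (d : measure_display)
    (T : measurableType d) (P : probability T R) (X : iid_sample n P)
    (s : state) : Prop :=
  forall k, {ae P, forall w, s \in (X k w).1}.

End MarkovRewardProcess.

Arguments is_value {R} M V.

(* Main.v *)
(* A state s loops with probability p (reward 0) and otherwise terminates with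
   reward 1; a single path (n = 1) is observed.  If it loops k times, then MC
   gives g^k and ML gives 1 / (k + 1 - g k), g being the discount.  The two
   agree for k = 0; for k = 1 and small g, MC is close to 0 and ML close to
   1/2, while V_s is about 1 - p.  So MC is better for p close to 1 and ML is
   better for p close to 0.  With g = 1/10 and p = 9/10, resp. p = 1/10, the
   terms k = 0, 1 and a crude bound on the tail k >= 2 of the smaller error
   suffice. *)
Require Import Defs.
From HB Require Import structures.
From mathcomp Require Import all_boot all_order all_algebra.
From mathcomp Require Import all_classical all_reals all_analysis.
From mathcomp Require Import ring lra measurable_realfun.
Set Implicit Arguments.
Unset Strict Implicit.
Unset Printing Implicit Defensive.
Import Order.TTheory GRing.Theory Num.Theory.
Local Open Scope classical_set_scope.
Local Open Scope ring_scope.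

(** * The geometric law on the natural numbers *)

Section GeometricDistribution.
Context {R : realType} (p : R) (p01 : 0 < p < 1).

Lemma geometric_pmf_ge0 k : 0 <= (1 - p) * p ^+ k.
Proof.
by case/andP: p01 => p0 p1; rewrite mulr_ge0 ?exprn_ge0 ?subr_ge0 ?ltW.
Qed.

(** The law of the number of loops before termination. As a countable sum of weighted Dirac masses
    it is a measure by construction, so only its total mass has to be computed. *)
Definition geometric_prob : set nat -> \bar R :=
  mseries (fun k => mscale (NngNum (geometric_pmf_ge0 k)) \d_k) 0.

HB.instance Definition _ := Measure.on geometric_prob.

Lemma geometric_prob_setT : geometric_prob setT = 1%E.
Proof.
case/andP: p01 => p0 p1.
rewrite /geometric_prob /mseries /=.
under eq_eseriesr do rewrite /mscale/= diracT mule1.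
have np1 : `|p| < 1 by rewrite ger0_norm ?ltW.
have /cvg_lim <- // : (fun n => (series (geometric (1 - p) p) n)%:E) @ \oo
    --> 1%E.
  apply: cvg_EFin; first exact: nearW.
  have := @cvg_geometric_series R (1 - p) p np1.
  by rewrite divff// subr_eq0 eq_sym lt_eqF.
by apply/congr_lim/funext => n /=; rewrite -sumEFin.
Qed.

HB.instance Definition _ :=
  Measure_isProbability.Build _ _ R geometric_prob geometric_prob_setT.

Lemma geometric_prob_set1 k :
  geometric_prob [set k] = ((1 - p) * p ^+ k)%:E.
Proof.
rewrite /geometric_prob /mseries /= (@nneseriesD1 _ _ k)//=.
rewrite /mscale/= diracE mem_set//= mule1 eseries0 ?adde0// => i _ ik.
by rewrite diracE memNset ?mule0//=; apply/eqP.
Qed.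

End GeometricDistribution.

(** * Bounds on the expectation of a non-negative function on [nat] from its first two values *)

Section Bounds.
Context {R : realType} (P : probability nat R) (f : nat -> R)
  (f_ge0 : forall k, 0 <= f k).

Lemma integral_nat_split2 :
  (\int[P]_k (f k)%:E = (f 0%N)%:E * P [set 0%N] + (f 1%N)%:E * P [set 1%N]
     + \int[P]_(k in [set k | (2 <= k)%N]) (f k)%:E)%E.
Proof.
have -> : [set: nat] = [set 0%N] `|` [set 1%N] `|` [set k | (2 <= k)%N].
  by apply/seteqP; split=> // -[|[|k]] _ /=; [left; left|left; right|right].
have f0 D k : D k -> (0 <= (f k)%:E)%E by rewrite lee_fin.
have set1 k : (\int[P]_(i in [set k]) (f i)%:E = (f k)%:E * P [set k])%E.
  rewrite -integral_cst//; apply: eq_integral => i.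
  by rewrite inE /= => ->.
rewrite ge0_integral_setU//; last 2 first.
- exact: f0.
- by apply/disj_setPLR => k [] -> .
rewrite ge0_integral_setU//; last 2 first.
- exact: f0.
- by apply/disj_setPLR => k ->.
by rewrite !set1.
Qed.

(** The tail is non-negative and is dropped; this serves for the larger of the two errors. *)
Lemma integral_nat_ge2 :
  ((f 0%N)%:E * P [set 0%N] + (f 1%N)%:E * P [set 1%N] <= \int[P]_k (f k)%:E)%E.
Proof.
rewrite integral_nat_split2 leeDl// integral_ge0// => k _.
by rewrite lee_fin.
Qed.

(** On the tail [f] is replaced by [c], and the tail has the mass left over by 0 and 1; this serves
    for the smaller of the two errors. *)
Lemma integral_nat_le2 c : (forall k, (2 <= k)%N -> f k <= c) ->
  (\int[P]_k (f k)%:E <=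
   (f 0%N)%:E * P [set 0%N] + (f 1%N)%:E * P [set 1%N]
     + c%:E * (1 - (P [set 0%N] + P [set 1%N])))%E.
Proof.
move=> fc; rewrite integral_nat_split2 leeD2l//.
have -> : (1 - (P [set 0%N] + P [set 1%N]) = P [set k | (2 <= k)%N])%E.
  rewrite -measureU//; last by apply/seteqP; split=> // k [/= ->].
  rewrite -probability_setC//; congr (P _).
  by apply/seteqP; split=> -[|[|k]] //=; [case; left|case; right|move=> _ []].
rewrite -integral_cst//; apply: ge0_le_integral => // k k2.
by rewrite lee_fin ?fc ?f_ge0.
Qed.

End Bounds.

(** * The self-loop process and its value *)

Section SelfLoop.
Context {R : realType} (p g : R) (p01 : 0 < p < 1) (g01 : 0 < g < 1).

(** [ord0] is the looping state, in which every run starts; [ord_max] is the terminal state. *)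
Definition loop_start (i : 'I_2) : R := (i == ord0)%:R.

Definition loop_trans : 'M[R]_2 :=
  \matrix_(i, j) if i == ord0 then if j == ord0 then p else 1 - p else 0.

Definition loop_reward (i j : 'I_2) : R := ((i == ord0) && (j != ord0))%:R.

Definition loop_reward_law (i j : 'I_2) :
  probability (measurableTypeR R) R :=
  @dirac _ (measurableTypeR R) (loop_reward i j) R.

Fact loop_start_ge0 i : 0 <= loop_start i.
Proof. exact: ler0n. Qed.

Fact loop_start_sum1 : \sum_i loop_start i = 1.
Proof. by rewrite !big_ord_recl big_ord0 /loop_start /= !addr0. Qed.

Fact loop_trans_ge0 i j : 0 <= loop_trans i j.
Proof. by case/andP: p01 => p0 p1; rewrite mxE; do 2?case: ifP => _; lra. Qed.

Fact loop_trans_sum1 i :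
  (forall j, loop_trans i j = 0) \/ \sum_j loop_trans i j = 1.
Proof.
have [->|i0] := eqVneq i ord0; [right|left].
  by rewrite !big_ord_recl big_ord0 !mxE /=; ring.
by move=> j; rewrite mxE (negbTE i0).
Qed.

Fact loop_reward_integrable i j :
  (loop_reward_law i j).-integrable setT (fun x : measurableTypeR R => x%:E).
Proof.
apply/integrableP; split; first exact/measurable_EFinP.
rewrite integral_dirac//; last exact/measurableT_comp/measurable_EFinP.
by rewrite diracT mul1e ltry.
Qed.

Fact loop_absorbing i : exists2 t, (forall j, loop_trans t j = 0) &
  connect [rel k l | 0 < loop_trans k l] i t.
Proof.
exists ord_max => [j|]; first by rewrite mxE.
have [->|i0] := eqVneq i ord0.
  by apply: connect1; rewrite /= mxE /= subr_gt0; case/andP: p01.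
suff -> : i = ord_max by exact: connect0.
by case: i i0 => -[|[|]]// ? _; exact: val_inj.
Qed.

Definition loop_MRP : MRP R := {|
  start_ge0 := loop_start_ge0;
  start_sum1 := loop_start_sum1;
  trans_ge0 := loop_trans_ge0;
  trans_sum1 := loop_trans_sum1;
  reward_integrable := loop_reward_integrable;
  discount_gt0 := proj1 (andP g01);
  discount_le1 := ltW (proj2 (andP g01));
  absorbing := loop_absorbing
|}.

(** At [ord0] this is the solution of V = p g V + (1 - p). *)
Definition loop_value (i : 'I_2) : R :=
  if i == ord0 then (1 - p) / (1 - g * p) else 0.

Lemma loop_mean_reward (i j : 'I_2) :
  mean_reward (M := loop_MRP) i j = loop_reward i j.
Proof.
rewrite /mean_reward /Rintegral /= integral_dirac//.
by rewrite diracT mul1e.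
Qed.

Lemma loop_is_value : is_value loop_MRP loop_value.
Proof.
move=> i; rewrite !big_ord_recl big_ord0 !loop_mean_reward /loop_value /=.
rewrite /loop_trans !mxE /loop_reward; case: ifP => //= i0; last by ring.
have gp : 1 - g * p != 0.
  case/andP: p01 => p0 p1; case/andP: g01 => g0 g1.
  by apply: lt0r_neq0; nra.
by field.
Qed.

(** * The law of a run and the sample *)

Definition loop_path (k : nat) : seq 'I_2 := rcons (nseq k ord0) ord_max.

Lemma loop_path_inj : injective loop_path.
Proof. by move=> k l /(congr1 size); rewrite !size_rcons !size_nseq => -[]. Qed.

Definition loop_rewards_in (k : nat) (B : nat -> set R) : Prop :=
  forall t, (t < k.+1)%N -> B t (t == k)%:R.

(** A walk does not list its current state, so [loop_path k] stands for k loops and the exit. Each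
    loop contributes a factor p and the exit 1 - p; the Dirac reward laws contribute the indicator
    that all rewards lie in [B]. *)
Lemma loop_walk_law k B :
  walk_law (M := loop_MRP) ord0 (loop_path k) B =
  ((1 - p) * p ^+ k * (`[< loop_rewards_in k B >])%:R)%:E.
Proof.
elim: k B => [|k IH] B /=.
  rewrite mxE/= expr0 mulr1 /loop_reward_law /= diracE /loop_reward /=.
  have -> : terminal (M := loop_MRP) ord_max.
    by apply/forallP => j; rewrite /= mxE.
  rewrite mule1 -EFinM; congr (_ * (nat_of_bool _)%:R)%:E.
  apply/idP/asboolP => [|/(_ 0%N)]; last by move=> H; rewrite inE; exact: H.
  by rewrite inE => B0 [].
rewrite IH mxE/= /loop_reward_law /= diracE /loop_reward /=.
rewrite -!EFinM; congr EFin.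
rewrite exprS.
have -> : `[< loop_rewards_in k.+1 B >] =
    (0 \in B 0%N) && `[< loop_rewards_in k (fun t => B t.+1) >].
  apply/asboolP/andP => [H|[]].
    split; first by rewrite inE; exact: (H 0%N).
    by apply/asboolP => t tk; exact: (H t.+1).
  by rewrite inE => B0 /asboolP H [|t] tk //=; exact: H.
by rewrite -mulnb natrM; ring.
Qed.

(** Any other walk either stops in [ord0], which is not terminal, or continues after [ord_max],
    whose row is zero. *)
Lemma loop_walk_law0 y B : (forall k, y <> loop_path k) ->
  walk_law (M := loop_MRP) ord0 y B = 0%E.
Proof.
elim: y B => [|j y IH] B yk /=.
  have /negbTE -> // : ~~ terminal (M := loop_MRP) ord0.
  by apply/forallPn; exists ord0; rewrite /= mxE/= gt_eqF//; case/andP: p01.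
have [j0|j0] := eqVneq j ord0.
  rewrite j0 IH ?mule0// => k yE; apply: (yk k.+1).
  by rewrite j0 yE.
have j1 : j = ord_max by case: j j0 {yk} => -[|[|]]// ? _; exact: val_inj.
case: y {IH} yk => [/(_ 0%N)|l y _]; first by rewrite j1.
by rewrite /= j1 !mxE/= !mul0e mule0.
Qed.

(** The sample space is [nat], an outcome being the number k of loops. The path has k + 1 copies of
    [ord0], the initial state included, and the exit reward comes at time k. *)
Definition loop_run (k : nat) : run loop_MRP :=
  (loop_path k.+1, fun t => (t == k)%:R).

Let P : probability nat R := geometric_prob p01.

(** The path determines k, so a basic event is a singleton or empty; its geometric mass is then
    compared with the walk law. *)
Lemma loop_run_law (x : seq 'I_2) (B : nat -> set R) :
  P (run_event (M := loop_MRP) loop_run x B) = run_law (M := loop_MRP) x B.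
Proof.
have [[k xk]|nx] := pselect (exists k, x = loop_path k.+1); last first.
  rewrite (_ : run_event _ _ _ = set0) ?measure0; last first.
    by apply/seteqP; split=> // k [xk _]; apply: nx; exists k.
  case: x nx => [//|i y nx] /=; rewrite /loop_start.
  have [i0|] := eqVneq i ord0; last by rewrite mul0e.
  rewrite i0 loop_walk_law0 ?mule0// => k yk.
  by apply: nx; exists k; rewrite i0 yk.
rewrite xk /= -/(loop_path k) loop_walk_law /loop_start /= mul1e.
case: asboolP => Bk.
  rewrite (_ : run_event _ _ _ = [set k]) /P ?geometric_prob_set1 ?mulr1//.
  apply/seteqP; split=> l /=; first by case=> /loop_path_inj[].
  move=> ->; split=> //= t; rewrite size_rcons size_nseq => tk.
  exact: Bk.
rewrite (_ : run_event _ _ _ = set0) ?measure0 ?mulr0//.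
apply/seteqP; split=> // l /= [/loop_path_inj[->] Bl]; apply: Bk => t tk.
by apply: Bl; rewrite /= size_rcons size_nseq.
Qed.

Definition loop_sample : iid_sample loop_MRP 1 P.
Proof.
refine (@Build_iid_sample R loop_MRP 1 _ _ P (fun=> loop_run) _ _ _ _) => //.
- by move=> _ x B _; exact: loop_run_law.
(* A subset of ['I_1] is empty or the singleton, so the product rule is trivial. *)
- move=> J x B _; have [J0|j] := set_0Vmem J.
    rewrite J0 big_set0 (_ : [set` _] = set0) ?bigcap_set0 ?probability_setT//.
    by apply/seteqP; split=> // i /=; rewrite inE.
  case: j => i iJ; have -> : J = [set i]%SET.
    by apply/setP => j; rewrite !inE (ord1 i) (ord1 j) eqxx -(ord1 i).
  rewrite big_set1 (_ : [set` _] = [set i]) ?bigcap_set1//.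
  by apply/seteqP; split=> j /=; rewrite inE => /eqP.
Defined.

Lemma loop_as_visited : as_visited loop_sample (ord0 : 'I_2).
Proof. by move=> k; apply: aeW => w. Qed.

(** * The two estimators on a run with k loops *)

Lemma mc_estimator_loop k :
  mc_estimator (M := loop_MRP) (fun _ : 'I_1 => loop_run k) ord0 = g ^+ k.
Proof.
rewrite /mc_estimator /= (eq_bigl xpredT) // big_ord1.
rewrite (@eq_card _ _ predT) // card_ord divr1.
rewrite /first_visit_return /= size_rcons size_nseq.
(* The first visit is at time 0, and only the last reward, at time k, is nonzero. *)
rewrite big_nat_recr //= eqxx mulr1 subn0 big_nat big1 ?add0r// => t /andP[_ tk].
by rewrite (ltn_eqF tk) mulr0.
Qed.

Lemma loop_transitions k :
  transitions (M := loop_MRP) (loop_path k.+1) =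
  rcons (nseq k (ord0, ord0)) (ord0, ord_max).
Proof.
elim: k => [|k IH] //.
by rewrite -[RHS]/((ord0, ord0) :: rcons (nseq k _) _) -IH.
Qed.

Section Counts.
Context (k : nat).
Let D := fun _ : 'I_1 => loop_run k.

Lemma loop_visits i :
  visits (M := loop_MRP) D i = if i == ord0 then k.+1 else 1%N.
Proof.
rewrite /visits big_ord1 /= -cats1 count_cat count_nseq /=.
by case: i => -[|[|]]//= ?; rewrite ?mul1n ?mul0n ?addn0 ?add1n.
Qed.

Lemma loop_trans_count i j :
  trans_count (M := loop_MRP) D i j =
  if i == ord0 then if j == ord0 then k else 1%N else 0%N.
Proof.
rewrite /trans_count big_ord1 loop_transitions -cats1 count_cat count_nseq /=.
rewrite !xpair_eqE (eq_sym _ i) (eq_sym _ j).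
case: i => -[|[|]]//= ?; case: j => -[|[|]]//= ?;
  by rewrite ?mul1n ?mul0n ?addn0.
Qed.

Lemma loop_reward_sum i j :
  reward_sum (M := loop_MRP) D i j = loop_reward i j.
Proof.
rewrite /reward_sum big_ord1 loop_transitions /=.
rewrite size_rcons size_nseq big_mkcond big_ord_recr big1 => [|t _] /=.
  rewrite nth_rcons size_nseq ltnn eqxx add0r /loop_reward xpair_eqE.
  case: i => -[|[|]]//= ?; case: j => -[|[|]]//= ?.
by rewrite (ltn_eqF (ltn_ord t)); case: ifP.
Qed.

Lemma loop_ml_trans : ml_trans (M := loop_MRP) D =
  \matrix_(i, j) if i == ord0 then
    if j == ord0 then k%:R / k.+1%:R else k.+1%:R^-1 else 0.
Proof.
apply/matrixP => i j; rewrite !mxE loop_visits loop_trans_count.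
by do 2?[case: ifP => _]; rewrite ?mul1r ?mul0r.
Qed.

Lemma loop_ml_reward : ml_reward (M := loop_MRP) D =
  \col_i if i == ord0 then k.+1%:R^-1 else 0.
Proof.
apply/matrixP => i j; rewrite !mxE !big_ord_recl big_ord0 /=.
rewrite loop_ml_trans !mxE /= /ml_mean_reward !loop_reward_sum !loop_trans_count.
rewrite /loop_reward /=.
by case: ifP => //= _; rewrite ?divr1; ring.
Qed.

(** The row of [ord0] reads (1 - g k / (k + 1)) v = 1 / (k + 1). The proof shows that the matrix is
    invertible and multiplies the claimed vector back. *)
Lemma loop_ml_value : ml_value (M := loop_MRP) D =
  \col_i if i == ord0 then (k.+1%:R - g * k%:R)^-1 else 0.
Proof.
case/andP: g01 => g0 g1; have k0 : 0 <= k%:R :> R := ler0n _ k.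
have k1 : k.+1%:R = 1 + k%:R :> R by rewrite -natr1 addrC.
have kg : 1 + k%:R - g * k%:R != 0 by apply: lt0r_neq0; nra.
have k1_neq0 : 1 + k%:R != 0 :> R by apply: lt0r_neq0; nra.
rewrite /ml_value; apply: canLR; first apply: mulKmx.
  (* The matrix is upper triangular and [det_trig] wants a lower triangular one, hence the
     transposition. *)
  rewrite unitmxE -det_tr det_trig => [|]; last first.
    apply/is_trig_mxP => i j; rewrite loop_ml_trans !mxE.
    by case: i => -[|[|]]//= ?; case: j => -[|[|]]//= ? _; rewrite mulr0 subr0.
  rewrite !big_ord_recl big_ord0 loop_ml_trans !mxE /=.
  rewrite (_ : _ * _ = (1 + k%:R - g * k%:R) / (1 + k%:R)).
    by rewrite unitfE mulf_neq0 ?invr_eq0.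
  by rewrite k1; field.
apply/matrixP => i j; rewrite loop_ml_reward loop_ml_trans !mxE.
rewrite !big_ord_recl big_ord0 !mxE /= k1.
by case: i => -[|[|]]//= ?; first field; rewrite ?kg ?k1_neq0//; ring.
Qed.

Lemma ml_estimator_loop :
  ml_estimator (M := loop_MRP) D ord0 = (k.+1%:R - g * k%:R)^-1.
Proof. by rewrite /ml_estimator loop_ml_value mxE. Qed.

End Counts.

(** * Bounds on the mean squared errors *)

Lemma mse_loop (est : ('I_1 -> run loop_MRP) -> R) (v : R) :
  mse loop_sample est v =
  (\int[P]_k ((est (fun=> loop_run k) - v) ^+ 2)%:E)%E.
Proof. by rewrite /mse unlock. Qed.

Let P_set1 k : P [set k] = ((1 - p) * p ^+ k)%:E.
Proof. exact: geometric_prob_set1. Qed.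

Lemma mse_loop_ge (est : ('I_1 -> run loop_MRP) -> R) (v : R) :
  (((est (fun=> loop_run 0) - v) ^+ 2 * (1 - p) +
    (est (fun=> loop_run 1) - v) ^+ 2 * ((1 - p) * p))%:E
  <= mse loop_sample est v)%E.
Proof.
rewrite mse_loop.
have := @integral_nat_ge2 R P (fun k => (est (fun=> loop_run k) - v) ^+ 2).
rewrite !P_set1 expr0 expr1 mulr1 -!EFinM -EFinD; apply => k.
exact: sqr_ge0.
Qed.

(** The factor p ^ 2 of [c] is the probability of at least two loops. *)
Lemma mse_loop_le (est : ('I_1 -> run loop_MRP) -> R) (v c : R) :
  (forall k, (2 <= k)%N -> (est (fun=> loop_run k) - v) ^+ 2 <= c) ->
  (mse loop_sample est v <=
   ((est (fun=> loop_run 0) - v) ^+ 2 * (1 - p) +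
    (est (fun=> loop_run 1) - v) ^+ 2 * ((1 - p) * p) + c * p ^+ 2)%:E)%E.
Proof.
move=> vc; rewrite mse_loop.
have := @integral_nat_le2 R P (fun k => (est (fun=> loop_run k) - v) ^+ 2) _ _ vc.
rewrite !P_set1 expr0 expr1 mulr1 -!EFinM -!EFinD.
rewrite (_ : 1 - (1 - p + (1 - p) * p) = p ^+ 2); last by ring.
by apply=> k; exact: sqr_ge0.
Qed.

End SelfLoop.

(** * Numerical comparison for p = 9/10 and p = 1/10 *)

Theorem mainTheorem11 (R : realType) :
  (exists (M : MRP R) (s : 'I_(nstates M)) (n : nat) (V : 'I_(nstates M) -> R),
    is_value M V /\
    exists (d : measure_display) (T : measurableType d) (P : probability T R)
           (X : iid_sample M n P),
      as_visited X s /\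
      (mse X (fun D => mc_estimator D s) (V s)
        < mse X (fun D => ml_estimator D s) (V s))%E)
  /\
  (exists (M : MRP R) (s : 'I_(nstates M)) (n : nat) (V : 'I_(nstates M) -> R),
    is_value M V /\
    exists (d : measure_display) (T : measurableType d) (P : probability T R)
           (X : iid_sample M n P),
      as_visited X s /\
      (mse X (fun D => ml_estimator D s) (V s)
        < mse X (fun D => mc_estimator D s) (V s))%E).
Proof.
have g01 : 0 < (10%:R^-1 : R) < 1 by apply/andP; split; lra.
have ml0 : (1%:R - 10%:R^-1 * 0%:R : R)^-1 = 1 by field.
have ml1 : (2%:R - 10%:R^-1 * 1%:R : R)^-1 = 10%:R / 19%:R by field.
split.
- have p01 : 0 < (9%:R / 10%:R : R) < 1 by apply/andP; split; lra.
  exists (loop_MRP p01 g01), ord0, 1%N, (loop_value (9%:R / 10%:R) 10%:R^-1).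
  split; first exact: loop_is_value.
  exists _, _, _, (loop_sample p01 g01); split; first exact: loop_as_visited.
  have -> : loop_value (9%:R / 10%:R : R) 10%:R^-1 ord0 = 10%:R / 91%:R.
    by rewrite /loop_value /=; field.
  apply: lt_le_trans (mse_loop_ge _ _).
  (* With V = 10/91, MC lies between 0 and g = 1/10, which is below 2 V, so its squared error is at
     most V ^ 2. *)
  have bound k : (2 <= k)%N ->
      (mc_estimator (fun _ : 'I_1 => loop_run p01 g01 k) ord0 - 10%:R / 91%:R) ^+ 2
        <= (10%:R / 91%:R) ^+ 2 :> R.
    case: k => // k _.
    rewrite mc_estimator_loop (exprS _ k).
    have : 0 <= (10%:R^-1 : R) ^+ k <= 1.
      by rewrite exprn_ge0 ?exprn_ile1 //; lra.
    move: (_ ^+ k) => x /andP[x0 x1].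
    (* This gives x ^ 2 <= x, after which the goal is linear in x and x ^ 2. *)
    have : 0 <= x * (1 - x) by rewrite mulr_ge0 ?subr_ge0.
    by lra.
  apply: le_lt_trans (mse_loop_le bound) _.
  (* Both estimators are 1 for k = 0, so these terms cancel; there remains about 0.0098 for MC
     against 0.0156 for ML. *)
  rewrite !mc_estimator_loop !ml_estimator_loop lte_fin ml0 ml1 expr0 expr1.
  by lra.
- have p01 : 0 < (10%:R^-1 : R) < 1 by [].
  exists (loop_MRP p01 g01), ord0, 1%N, (loop_value 10%:R^-1 10%:R^-1).
  split; first exact: loop_is_value.
  exists _, _, _, (loop_sample p01 g01); split; first exact: loop_as_visited.
  have -> : loop_value (10%:R^-1 : R) 10%:R^-1 ord0 = 10%:R / 11%:R.
    by rewrite /loop_value /=; field.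
  apply: lt_le_trans (mse_loop_ge _ _).
  (* With V = 10/11, ML lies between 0 and 1, which is below 2 V, so its squared error is again at
     most V ^ 2. *)
  have bound k : (2 <= k)%N ->
      (ml_estimator (fun _ : 'I_1 => loop_run p01 g01 k) ord0 - 10%:R / 11%:R) ^+ 2
        <= (10%:R / 11%:R) ^+ 2 :> R.
    move=> _.
    rewrite ml_estimator_loop -natr1.
    have k0 : 0 <= k%:R :> R := ler0n _ k.
    have : 0 <= (k%:R + 1 - 10%:R^-1 * k%:R : R)^-1 <= 1.
      by rewrite invr_ge0 invf_le1; lra.
    move: (_^-1 : R) => x /andP[x0 x1].
    have : 0 <= x * (1 - x) by rewrite mulr_ge0 ?subr_ge0.
    by lra.
  apply: le_lt_trans (mse_loop_le bound) _.
  (* After cancelling the terms for k = 0 there remains about 0.0215 for ML against 0.0589 for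
     MC. *)
  rewrite !mc_estimator_loop !ml_estimator_loop lte_fin ml0 ml1 expr0 expr1.
  by lra.
Qed.
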